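(* Let $n\ge5$ and let $\mathcal P$ be the regular $n$-polytope with automorphism group $S_{n+3}$ whose CPR graph is the path on $n+3$ vertices with edges labeled, in order along the path, $1,0,1,2,3,4,\dots,n-3,n-2,n-1,n-2$. Then $\mathcal P$ is internally self-dual.
   Context: A string C-group is a group generated by involutions $\rho_0,\dots,\rho_{n-1}$ with $(\rho_i\rho_j)^2=1$ whenever $|i-j|\ge2$ and $\langle\rho_i\mid i\in I\rangle\cap\langle\rho_i\mid i\in J\rangle=\langle\rho_i\mid i\in I\cap J\rangle$ for all $I,J\subseteq\{0,\dots,n-1\}$. Regular abstract $n$-polytopes correspond exactly to string C-groups of rank $n$: the automorphism group $\Gamma(\mathcal P)$ of a regular $n$-polytope with base flag $\Phi$ is a string C-group with distinguished generators $\rho_i$, where $\Phi\rho_i$ is the flag differing from $\Phi$ in exactly the $i$-face, and every string C-group determines a unique such polytope. The CPR graph of a string C-group given as a permutation group has one vertex for each permuted point and an edge labeled $i$ joining $a$ and $b$ whenever $\rho_i$ interchanges $a\ne b$; thus here $\rho_i\in S_{n+3}$ is the product of the transpositions given by the edges with label $i$. It is known that for $n\ge5$ the permutations $\rho_0,\dots,\rho_{n-1}$ read off the path in the claim generate $S_{n+3}$ and form a string C-group, so $\mathcal P$ exists. A polytope is self-dual if it admits an order-reversing bijection to itself. A regular self-dual $n$-polytope is internally self-dual if there is $\alpha\in\Gamma(\mathcal P)$ with $\alpha\rho_i=\rho_{n-i-1}\alpha$ for $0\le i\le n-1$. *)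

(* Defs.v *)
From HB Require Import structures.
From mathcomp Require Import all_boot all_order all_algebra all_fingroup.
From mathcomp Require Import boolp classical_sets functions cardinality.

Set Implicit Arguments.
Unset Strict Implicit.
Unset Printing Implicit Defensive.

Import Order.TTheory GRing.Theory Num.Theory.

Local Open Scope classical_set_scope.
Local Open Scope order_scope.

Definition is_chain d (P : porderType d) (C : set P) : Prop :=
  total_on C (fun x y => x <= y).

Definition is_flag d (P : porderType d) (F : set P) : Prop :=
  is_chain F /\ forall C : set P, is_chain C -> F `<=` C -> C = F.

Definition differ_exactly_at d (P : porderType d) (rk : P -> int) (i : int)
    (F G : set P) : Prop :=
  F <> G /\ forall x, rk x <> i -> (F x <-> G x).

Definition adjacent_flags d (P : porderType d) (rk : P -> int)
    (F G : set P) : Prop :=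
  [/\ is_flag F, is_flag G & exists i, differ_exactly_at rk i F G].

Definition strongly_flag_connected d (P : porderType d) (rk : P -> int) : Prop :=
  forall F G : set P, is_flag F -> is_flag G ->
  exists k (s : nat -> set P),
    [/\ s 0%N = F, s k = G,
        forall j, (j < k)%N -> adjacent_flags rk (s j) (s j.+1)
      & forall j, (j <= k)%N -> F `&` G `<=` s j].

(* Following McMullen and Schulte; the least and greatest faces are the \bot  *)
(* and \top of [P]. Finiteness of [P] is not part of the definition.          *)
Record abstract_polytope (n : nat) d (P : tbPOrderType d) (rk : P -> int) :
    Prop := AbstractPolytope {
  rank_range : forall x, (-1 <= rk x <= n%:Z)%R;
  rank_mono : forall x y : P, x < y -> (rk x < rk y)%R;
  flag_card : forall F : set P, is_flag F -> (F #= `I_n.+2)%card;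
  flag_connected : strongly_flag_connected rk;
  diamond : forall x y : P, x < y -> rk y = (rk x + 2)%R ->
    ([set z | x < z < y] #= `I_2)%card
}.

Record polytope_aut d (P : porderType d) := PolytopeAut {
  autf :> P -> P;
  autf_inv : P -> P;
  autfK : cancel autf autf_inv;
  autf_invK : cancel autf_inv autf;
  autf_mono : {mono autf : x y / x <= y}
}.

Lemma polytope_aut_eqP d (P : porderType d) (f g : polytope_aut P) :
  (f : P -> P) =1 g -> f = g.
Proof.
case: f g => [f f' fK f'K fm] [g g' gK g'K gm] /= /funext fg.
move: fK f'K fm; rewrite fg => fK f'K fm.
have fg' : f' = g' by apply/funext => x; rewrite -{1}[x]g'K fK.
by move: fK f'K; rewrite fg' => fK f'K; congr PolytopeAut; apply: Prop_irrelevance.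
Qed.

HB.instance Definition _ d (P : porderType d) := gen_eqMixin (polytope_aut P).
HB.instance Definition _ d (P : porderType d) :=
  gen_choiceMixin (polytope_aut P).

Definition paut1 d (P : porderType d) : polytope_aut P :=
  @PolytopeAut d P id id (fun _ => erefl) (fun _ => erefl) (fun _ _ => erefl).

Lemma paut_inv_mono d (P : porderType d) (f : polytope_aut P) :
  {mono autf_inv f : x y / x <= y}.
Proof. by move=> x y; rewrite -(autf_mono f) !autf_invK. Qed.

Definition paut_inv d (P : porderType d) (f : polytope_aut P) :=
  PolytopeAut (autf_invK f) (autfK f) (paut_inv_mono f).

Lemma paut_mul_mono d (P : porderType d) (f g : polytope_aut P) :
  {mono g \o f : x y / x <= y}.
Proof. by move=> x y /=; rewrite !autf_mono. Qed.

(* Automorphisms act on the right, as permutations do: in [f * g], [f] is     *)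
(* applied first.                                                             *)
Definition paut_mul d (P : porderType d) (f g : polytope_aut P) :=
  PolytopeAut (can_comp (autfK g) (autfK f))
    (can_comp (autf_invK f) (autf_invK g)) (paut_mul_mono f g).

Lemma paut_mulA d (P : porderType d) : associative (@paut_mul d P).
Proof. by move=> f g h; apply: polytope_aut_eqP. Qed.

Lemma paut_mul1g d (P : porderType d) : left_id (paut1 P) (@paut_mul d P).
Proof. by move=> f; apply: polytope_aut_eqP. Qed.

Lemma paut_mulg1 d (P : porderType d) : right_id (paut1 P) (@paut_mul d P).
Proof. by move=> f; apply: polytope_aut_eqP. Qed.

Lemma paut_mulVg d (P : porderType d) :
  left_inverse (paut1 P) (@paut_inv d P) (@paut_mul d P).
Proof. by move=> f; apply: polytope_aut_eqP => x; apply: autf_invK. Qed.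

Lemma paut_mulgV d (P : porderType d) :
  right_inverse (paut1 P) (@paut_inv d P) (@paut_mul d P).
Proof. by move=> f; apply: polytope_aut_eqP => x; apply: autfK. Qed.

HB.instance Definition _ d (P : porderType d) :=
  isGroup.Build (polytope_aut P) (@paut_mulA d P) (@paut_mul1g d P)
    (@paut_mulg1 d P) (@paut_mulVg d P) (@paut_mulgV d P).

Definition regular_polytope (n : nat) d (P : tbPOrderType d) (rk : P -> int) :
    Prop :=
  abstract_polytope n rk /\
  forall F G : set P, is_flag F -> is_flag G ->
    exists f : polytope_aut P, f @` F = G.

Definition distinguished_generators (n : nat) d (P : tbPOrderType d)
    (rk : P -> int) (F : set P) (rho : 'I_n -> polytope_aut P) : Prop :=
  forall i : 'I_n, differ_exactly_at rk i%:Z F (rho i @` F).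

Definition self_dual d (P : porderType d) : Prop :=
  exists delta : P -> P,
    bijective delta /\ forall x y, (delta x <= delta y) = (y <= x).

(* [rev_ord i] has value [n - i - 1]. *)
Definition internally_self_dual (n : nat) d (P : tbPOrderType d)
    (rho : 'I_n -> polytope_aut P) : Prop :=
  self_dual P /\
  exists alpha : polytope_aut P,
    forall i : 'I_n, (alpha * rho i = rho (rev_ord i) * alpha)%g.

Definition cpr_edge (n m : nat) (s : 'I_n -> 'S_m) (i : 'I_n) (a b : 'I_m) :
    bool :=
  [&& a != b, s i a == b & s i b == a].

(* Edge labels 1, 0, 1, 2, ..., n-3, n-2, n-1, n-2 in order along the path;   *)
(* the entry of index [k] labels the edge joining vertices [k] and [k + 1].   *)
Definition path_labels (n : nat) : seq nat :=
  1%N :: rcons (iota 0 n) (n - 2)%N.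

Definition path_edge (n m : nat) (i : 'I_n) (a b : 'I_m) : bool :=
  ((b == a.+1 :> nat) && (nth 0%N (path_labels n) a == i))
  || ((a == b.+1 :> nat) && (nth 0%N (path_labels n) b == i)).

(* Main.v *)
Require Import Defs.
From mathcomp Require Import all_boot all_order all_algebra all_fingroup.
From mathcomp Require Import boolp classical_sets functions cardinality.
From mathcomp Require Import zify.

(** The label sequence of the path is invariant under reading it backwards and
    replacing each label [i] by [n - i - 1]. Hence the reversal [pi] of the
    path carries the transpositions of the edges labeled [i] to those of the
    edges labeled [n - i - 1], that is, [pi] conjugates one generator to the
    other ([path_edge_rev], [reversal_conj]). Every permutation of the points
    comes from an automorphism of the polytope, so [pi] is the image of an
    involution [alpha] of the automorphism group, the element that is sought.

    A graph of transpositions determines a permutation only if that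
    permutation is an involution, so one needs [rho i * rho i = 1]
    ([rho_invol]). This comes from the polytope: by the diamond condition a
    flag has a unique [i]-adjacent flag ([adjacent_unique]), so [rho i] takes
    the [i]-adjacent flag of the base flag back to it; and by flag
    connectedness an automorphism that fixes one flag is the identity
    ([aut_fix_flag]).

    It remains to turn conjugation by [alpha] into an order-reversing
    bijection of the faces ([self_dual_of_reversing]). The polytope being
    regular, every face is [f p] with [f] an automorphism and [p] in the base
    flag; it is sent to [f' q], where [f'] is the conjugate of [f] by [alpha]
    and [q] is the base face of the complementary rank.
    - This does not depend on [f]: strong flag connectedness writes each
      automorphism fixing [p] as a product of generators [rho i] with [i]
      different from the rank of [p], and conjugation by [alpha] turns them
      into generators fixing [q] ([alpha_conj_fix]).
    - It reverses the order: comparable faces lie in a common flag, the image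
      of the base flag under a single [f], so the comparison takes place
      inside the base flag ([dual_rel_le]).
    - It is an involution because [alpha] is one. *)

(** * Chains, flags and automorphisms of a poset *)

Section Flags.
Set Implicit Arguments.
Unset Strict Implicit.
Import Order.TTheory GRing.Theory Num.Theory.
Local Open Scope classical_set_scope.
Local Open Scope order_scope.

Lemma card2_eq (T : Type) (A : set T) x y z :
  (A #= `I_2)%card -> A x -> A y -> A z -> x <> y -> x <> z -> y = z.
Proof.
move=> /card_set_bijP[f [ff fi _]] Ax Ay Az xy xz.
have inj u v : A u -> A v -> f u = f v -> u = v.
  by move=> Au Av; apply: fi; rewrite inE.
have := ff _ Ax; have := ff _ Ay; have := ff _ Az; rewrite /= => fz fy fx.
have /eqP nxy : f x <> f y by move/inj => /(_ Ax Ay).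
have /eqP nxz : f x <> f z by move/inj => /(_ Ax Az).
by apply: inj => //; lia.
Qed.

(** Zorn's lemma is applied to the sets whose union with [C] is a chain rather
    than to the chains containing [C], because the empty family of chains has
    the empty union, which need not contain [C]. *)
Lemma chain_sub_flag d (P : porderType d) (C : set P) :
  is_chain C -> exists F, is_flag F /\ C `<=` F.
Proof.
move=> chC.
have [|A [chA Amax]] := @Zorn_bigcup P (fun X => is_chain (X `|` C)).
  move=> F FP Ftot x y.
  case=> [[X FX Xx]|Cx] [[Y FY Yy]|Cy].
  - have [XY|YX] := Ftot _ _ FX FY.
      by apply: (FP _ FY); left => //; apply: XY.
    by apply: (FP _ FX); left => //; apply: YX.
  - by apply: (FP _ FX); [left|right].
  - by apply: (FP _ FY); [right|left].
  - exact: chC.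
exists (A `|` C); split; last by move=> x; right.
split=> // D chD ACD; apply/seteqP; split=> // x Dx.
have [AD|nAD] := pselect (D `<=` A); first by left; apply: AD.
exfalso; apply: (Amax D).
  rewrite properEneq; split; first by apply/eqP => e; apply: nAD; rewrite e.
  by move=> y Ay; apply: ACD; left.
by rewrite setUidl// => y Cy; apply: ACD; right.
Qed.

Lemma le_flag d (P : porderType d) (x y : P) :
  x <= y -> exists F, [/\ is_flag F, F x & F y].
Proof.
move=> xy; have [|F [Ff sF]] := @chain_sub_flag _ _ [set x; y].
  by move=> u v [->|->] [->|->]; rewrite ?xy ?lexx; [left|left|right|left].
by exists F; split=> //; apply: sF; [left|right].
Qed.

Lemma mem_flag d (P : porderType d) (F : set P) x :
  is_flag F -> (forall y, F y -> x <= y \/ y <= x) -> F x.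
Proof.
move=> [chF maxF] cx; rewrite -(maxF (F `|` [set x])); first by right.
  move=> u v [Fu|->] [Fv|->]; [exact: chF | | exact: cx | by rewrite lexx; left].
  by have [] := cx _ Fu; [right|left].
by move=> y; left.
Qed.

Lemma autf_flag d (P : porderType d) (f : polytope_aut P) (F : set P) :
  is_flag F -> is_flag (f @` F).
Proof.
move=> [chF maxF]; split.
  by move=> _ _ [x Fx <-] [y Fy <-]; rewrite !autf_mono; apply: chF.
move=> C chC FC; rewrite -(maxF (f @^-1` C)).
- apply/seteqP; split=> [y Cy|_ [x + <-]//].
  by exists (autf_inv f y); rewrite /= autf_invK.
- by move=> x y Cx Cy; rewrite -(autf_mono f x) -(autf_mono f y); apply: chC.
- by move=> x Fx; apply: FC; exists x.
Qed.

Lemma image_paut_mul d (P : porderType d) (f g : polytope_aut P) (F : set P) :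
  (f * g)%g @` F = g @` (f @` F).
Proof. by rewrite image_comp. Qed.

Lemma image_paut1 d (P : porderType d) (F : set P) :
  (1%g : polytope_aut P) @` F = F.
Proof. by rewrite image_id. Qed.

(** * Ranks and adjacent flags in a polytope *)

Section Polytope.
Context (n : nat) (d : Order.disp_t) (P : tbPOrderType d) (rk : P -> int).
Hypothesis polyP : abstract_polytope n rk.
Implicit Types (F G H : set P) (f g : polytope_aut P).

Lemma flag_rank_inj F x y : is_flag F -> F x -> F y -> rk x = rk y -> x = y.
Proof.
move=> [chF _] Fx Fy rxy.
have [] := chF _ _ Fx Fy; rewrite le_eqVlt => /orP[/eqP//|/(rank_mono polyP)];
  by rewrite rxy ltxx.
Qed.

Lemma flag_rank_lt F x y :
  is_flag F -> F x -> F y -> (rk x < rk y)%R -> x < y.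
Proof.
move=> [chF _] Fx Fy rxy.
have [|yx] := chF _ _ Fx Fy.
  by rewrite le_eqVlt => /orP[/eqP xy|//]; rewrite xy ltxx in rxy.
move: yx; rewrite le_eqVlt => /orP[/eqP xy|/(rank_mono polyP)].
  by rewrite xy ltxx in rxy.
by move=> /(lt_trans rxy); rewrite ltxx.
Qed.

(** The rank is injective on a flag, and a flag has as many elements as there
    are ranks. *)
Lemma flag_rank_surj F (k : int) :
  is_flag F -> (-1 <= k <= n%:Z)%R -> exists2 x, F x & rk x = k.
Proof.
move=> Ff kn.
have /card_set_bijP[c [_ _ csurj]] := flag_card polyP Ff.
have /choice[h hP] : forall i : 'I_n.+2, exists x, F x /\ c x = i.
  by move=> i; have [x Fx cx] := csurj i (ltn_ord i); exists x.
(* Ranks start at [-1], hence the shift by one. *)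
pose g (i : 'I_n.+2) : 'I_n.+2 := inord (absz (rk (h i) + 1)%R).
have gE i : (g i)%:Z%R = (rk (h i) + 1)%R.
  have := rank_range polyP (h i) => hi.
  by rewrite /g inordK; lia.
have ginj : injective g.
  move=> i j gij; have rij : rk (h i) = rk (h j).
    by have := gE i; have := gE j; rewrite gij; lia.
  have [Fi ci] := hP i; have [Fj cj] := hP j.
  by apply: ord_inj; rewrite -ci -cj (flag_rank_inj Ff Fi Fj rij).
have [g' _ g'K] := injF_bij ginj.
have := gE (g' (inord (absz (k + 1)%R))); rewrite g'K inordK; last by lia.
move=> rE; exists (h (g' (inord (absz (k + 1)%R)))); last by lia.
by have [] := hP (g' (inord (absz (k + 1)%R))).
Qed.

Lemma flag_bot F : is_flag F -> F \bot.
Proof. by move=> Ff; apply: mem_flag => // y _; left; apply: le0x. Qed.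

Lemma flag_top F : is_flag F -> F \top.
Proof. by move=> Ff; apply: mem_flag => // y _; right; apply: lex1. Qed.

Lemma flag_rank_bot F x : is_flag F -> F x -> rk x = (-1)%R -> x = \bot.
Proof.
move=> Ff Fx rx; apply/eqP; rewrite -[_ == _]negbK -lt0x; apply/negP.
by move=> /(rank_mono polyP); rewrite rx ltNge; case/andP: (rank_range polyP \bot) => ->.
Qed.

Lemma flag_rank_top F x : is_flag F -> F x -> rk x = n%:Z%R -> x = \top.
Proof.
move=> Ff Fx rx; apply/eqP; rewrite -[_ == _]negbK -ltx1; apply/negP.
by move=> /(rank_mono polyP); rewrite rx ltNge; case/andP: (rank_range polyP \top) => _ ->.
Qed.

(** An automorphism cannot lower a rank: below a face of rank [r] there is a
    strictly increasing sequence of faces of ranks [-1] to [r - 1], its image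
    is strictly increasing as well, and no rank is below [-1]. The inverse
    automorphism gives the other inequality. *)
Lemma rk_autf f x : rk (f x) = rk x.
Proof.
suff rk_ge g y : (rk y <= rk (g y))%R.
  apply/eqP; rewrite eq_le rk_ge andbT.
  by have := rk_ge (paut_inv f) (f x); rewrite /= autfK.
have := rank_range polyP y.
have [m] : exists m : nat, (rk y + 1)%R = m.
  by have := rank_range polyP y; exists (absz (rk y + 1)%R); lia.
elim: m y => [|m IH] y ym yr; first by have := rank_range polyP (g y); lia.
have [F [Ff Fy _]] := le_flag (lexx y).
have [|z Fz rz] := @flag_rank_surj F (rk y - 1)%R Ff; first by lia.
have zy : z < y by apply: (flag_rank_lt Ff) => //; lia.
have := rank_mono polyP (x := g z) (y := g y).
rewrite (leW_mono (autf_mono g)) zy => /(_ isT).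
by have := IH z; lia.
Qed.

(** Flags cannot differ at rank [-1] or [n], as they all contain the least and
    the greatest face. *)
Lemma differ_rank F G i : is_flag F -> is_flag G ->
  differ_exactly_at rk i F G -> (0 <= i < n%:Z)%R.
Proof.
move=> Ff Gf [FG FGi]; apply/negPn/negP => ni; apply: FG.
suff sub F' G' : is_flag F' -> is_flag G' ->
    (forall x, rk x <> i -> (F' x <-> G' x)) -> F' `<=` G'.
  by apply/seteqP; split; apply: sub => // x /FGi h; split=> /h.
move=> Ff' Gf' h x F'x; have [rx|/h[+ _]] := pselect (rk x = i); last exact.
have := rank_range polyP x => rr.
have [r|r] : rk x = (-1)%R \/ rk x = n%:Z%R by lia.
  by rewrite (flag_rank_bot Ff' F'x r); apply: flag_bot.
by rewrite (flag_rank_top Ff' F'x r); apply: flag_top.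
Qed.

Lemma differ_sym F G i :
  differ_exactly_at rk i F G -> differ_exactly_at rk i G F.
Proof. by move=> [FG h]; split; [exact: nesym | move=> x /h[]; split]. Qed.

Lemma differ_autf f F G i : differ_exactly_at rk i F G ->
  differ_exactly_at rk i (f @` F) (f @` G).
Proof.
move=> [FG h]; split.
  move=> e; apply: FG; rewrite -[F]image_paut1 -[G]image_paut1 -(mulgV f).
  by rewrite !image_paut_mul e.
by move=> y ry; split=> -[x x1 xy]; exists x => //;
  apply/h => //; rewrite -(rk_autf f) xy.
Qed.

(** The faces of rank [i] of the three flags lie strictly between the common
    faces of ranks [i - 1] and [i + 1], where the diamond condition leaves only
    one choice besides the face of [F]. *)
Lemma adjacent_unique F G H i : is_flag F -> is_flag G -> is_flag H ->
  differ_exactly_at rk i F G -> differ_exactly_at rk i F H -> G = H.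
Proof.
move=> Ff Gf Hf FG FH.
have ir := differ_rank Ff Gf FG.
have [|a Fa ra] := @flag_rank_surj F (i - 1)%R Ff; first by lia.
have [|b Fb rb] := @flag_rank_surj F (i + 1)%R Ff; first by lia.
have [|x Fx rx] := @flag_rank_surj F i Ff; first by lia.
have other G' : is_flag G' -> differ_exactly_at rk i F G' ->
    exists y, [/\ G' y, rk y = i, a < y < b & x <> y].
  move=> Gf' [FG' h]; have [|y Gy ry] := @flag_rank_surj G' i Gf'; first by lia.
  exists y; split=> //.
    apply/andP; split; apply: (flag_rank_lt Gf') => //; try lia;
      by apply/h => //; lia.
  move=> xy; apply: FG'; apply/seteqP; split=> z z1;
    (have [rz|/h h'] := pselect (rk z = i); last by apply/h').
  - by rewrite (flag_rank_inj Ff z1 Fx) ?rx// xy.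
  - by rewrite (flag_rank_inj Gf' z1 Gy) ?ry// -xy.
have [y [Gy ry aby xy]] := other G Gf FG.
have [z [Hz rz abz xz]] := other H Hf FH.
have yz : y = z.
  apply: (@card2_eq _ [set t | a < t < b] x) => //.
    by apply: (diamond polyP); [apply: (flag_rank_lt Ff) => //|]; lia.
  by apply/andP; split; apply: (flag_rank_lt Ff) => //; lia.
case: FG => _ h; case: FH => _ h'.
apply/seteqP; split=> t t1;
  (have [rt|rt] := pselect (rk t = i); last by apply/h'/h || apply/h/h').
- by rewrite (flag_rank_inj Gf t1 Gy) ?ry// yz.
- by rewrite (flag_rank_inj Hf t1 Hz) ?rz// -yz.
Qed.

(** An automorphism that fixes a flag fixes its unique [i]-adjacent flag for
    every [i], hence every flag, hence, ranks being preserved, every face. *)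
Lemma aut_fix_flag f F : is_flag F -> f @` F = F -> f = 1%g.
Proof.
move=> Ff fF; apply: polytope_aut_eqP => x.
have [G [Gf Gx _]] := le_flag (lexx x).
suff fG : f @` G = G.
  by apply: (flag_rank_inj Gf); rewrite ?rk_autf// -fG; exists x.
have [k [s [s0 sk sadj _]]] := flag_connected polyP Ff Gf.
suff fs j : (j <= k)%N -> f @` (s j) = s j by rewrite -sk fs.
elim: j => [_|j IH jk]; first by rewrite s0.
have [Sf Sf' [i di]] := sadj _ jk.
apply: (@adjacent_unique (s j) _ _ i) => //; first exact: autf_flag.
by rewrite -{1}(IH (ltnW jk)); apply: differ_autf.
Qed.

Lemma aut_flag_inj f g F : is_flag F -> f @` F = g @` F -> f = g.
Proof.
move=> Ff fg; apply: (mulIg g^-1%g); rewrite mulgV.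
apply: (aut_fix_flag Ff); rewrite image_paut_mul fg -image_paut_mul mulgV.
exact: image_paut1.
Qed.

(** * Distinguished generators *)

Section Generators.
Context (Phi : set P) (rho : 'I_n -> polytope_aut P).
Hypotheses (Phif : is_flag Phi) (rhoP : distinguished_generators rk Phi rho).

Lemma rho_fix (i : 'I_n) x : Phi x -> rk x <> i%:Z%R -> rho i x = x.
Proof.
move=> Px rx; have [_ /(_ x rx)[/(_ Px) h _]] := rhoP i.
by apply: (flag_rank_inj (autf_flag (rho i) Phif)); rewrite ?rk_autf//; exists x.
Qed.

Lemma rho_invol (i : 'I_n) : (rho i * rho i)%g = 1%g.
Proof.
apply: (aut_fix_flag Phif); rewrite image_paut_mul.
apply: (@adjacent_unique (rho i @` Phi) _ _ i) => //.
- exact: autf_flag.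
- by do 2 apply: autf_flag.
- by apply: differ_autf; apply: rhoP.
- by apply: differ_sym; apply: rhoP.
Qed.

(** * The duality induced by a group element reversing the generators *)

Section Duality.
Context (alpha : polytope_aut P).
Hypotheses (regP : forall F G, is_flag F -> is_flag G ->
                     exists f : polytope_aut P, f @` F = G)
  (alpha_invol : (alpha * alpha)%g = 1%g)
  (alpha_rho : forall i : 'I_n, (alpha * rho i = rho (rev_ord i) * alpha)%g).

Let alpha_conj f : polytope_aut P := (alpha * f * alpha)%g.

Lemma alpha_conjM f g : alpha_conj (f * g)%g = (alpha_conj f * alpha_conj g)%g.
Proof.
by rewrite /alpha_conj !mulgA -(mulgA (alpha * f)%g alpha) alpha_invol mulg1.
Qed.

Lemma alpha_conjK f : alpha_conj (alpha_conj f) = f.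
Proof.
by rewrite /alpha_conj !mulgA alpha_invol mul1g -mulgA alpha_invol mulg1.
Qed.

Lemma alpha_conj_rho i : alpha_conj (rho i) = rho (rev_ord i).
Proof. by rewrite /alpha_conj alpha_rho -mulgA alpha_invol mulg1. Qed.

(** Strong flag connectedness joins the base flag to its image under [f] by a
    path of flags that all contain [p]. Each step of the path multiplies the
    automorphism reached so far by some [rho i] with [i <> rk p], whose
    conjugate [rho (rev_ord i)] fixes [q]; and only [f] takes the base flag to
    the end of the path. *)
Lemma alpha_conj_fix f p q : Phi p -> Phi q -> (rk p + rk q = n%:Z - 1)%R ->
  f p = p -> alpha_conj f q = q.
Proof.
move=> Pp Pq rpq fp.
have [k [s [s0 sk sadj scap]]] :=
  flag_connected polyP Phif (autf_flag f Phif).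
have ps j : (j <= k)%N -> s j p.
  by move=> jk; apply: (scap _ jk); split=> //; exists p.
suff [w [wk cw]] :
    exists w : polytope_aut P, w @` Phi = s k /\ alpha_conj w q = q.
  by rewrite sk in wk; rewrite -(aut_flag_inj Phif wk).
have := leqnn k; elim: {1 3}k => [_|j IH jk].
  exists 1%g; rewrite s0 image_paut1; split=> //.
  by rewrite /alpha_conj mulg1 alpha_invol.
have [w [wj cw]] := IH (ltnW jk).
have [Sf Sf' [i di]] := sadj _ jk.
have ir := differ_rank Sf Sf' di.
(* Both flags contain [p], so they agree at its rank. *)
have rpi : rk p <> i.
  move=> e; case: di => ne h; apply: ne.
  apply/seteqP; split=> x x1;
    (have [rx|/h h'] := pselect (rk x = i); last by apply/h').
  - by rewrite (flag_rank_inj Sf x1 (ps _ (ltnW jk))) ?rx ?e//; apply: ps.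
  - by rewrite (flag_rank_inj Sf' x1 (ps _ jk)) ?rx ?e//; apply/ps/ltnW.
have im : (absz i < n)%N by lia.
pose m := Ordinal im; have mi : m%:Z%R = i by rewrite /=; lia.
(* [rho m] is applied first: it moves the base flag to its [i]-adjacent flag,
   and [w] moves that one to the [i]-adjacent flag of [s j]. *)
exists (rho m * w)%g; split.
  apply: (@adjacent_unique (s j) _ _ i) => //; first exact: autf_flag.
  by rewrite -wj image_paut_mul -mi; apply/differ_autf/rhoP.
have rmq : rho (rev_ord m) q = q.
  by apply: rho_fix => //=; lia.
by rewrite alpha_conjM alpha_conj_rho -[RHS]cw -[in RHS]rmq.
Qed.

(** The graph of the duality. A relation avoids choosing an automorphism for
    each face before the choice is known to be immaterial, and makes the
    involutivity of the duality a plain symmetry. *)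
Definition dual_rel x y := exists f p q,
  [/\ Phi p, Phi q, (rk p + rk q = n%:Z - 1)%R, x = f p & y = alpha_conj f q].

Lemma dual_rel_sym x y : dual_rel x y -> dual_rel y x.
Proof.
move=> [f [p [q [Pp Pq r -> ->]]]]; exists (alpha_conj f), q, p; split=> //.
  by rewrite addrC.
by rewrite alpha_conjK.
Qed.

Lemma dual_rel_fun x y z : dual_rel x y -> dual_rel x z -> y = z.
Proof.
move=> [f [p [q [Pp Pq r -> ->]]]] [g [p' [q' [Pp' Pq' r' e ->]]]].
have rp : rk p = rk p' by rewrite -(rk_autf f) e rk_autf.
have pp : p = p' by apply: (flag_rank_inj Phif).
have qq : q = q' by apply: (flag_rank_inj Phif) => //; lia.
subst p' q'.
have /(alpha_conj_fix Pp Pq r) : (f * g^-1)%g p = p by rewrite /= e autfK.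
have -> : (f * g^-1 = f * paut_inv g)%g by [].
move=> /(congr1 (alpha_conj g)).
have -> : alpha_conj g (alpha_conj (f * paut_inv g)%g q)
    = (alpha_conj (f * paut_inv g) * alpha_conj g)%g q by [].
by rewrite -alpha_conjM -mulgA mulVg mulg1.
Qed.

Lemma dual_rel_le x x' : x <= x' ->
  exists y y', [/\ dual_rel x y, dual_rel x' y' & y' <= y].
Proof.
move=> xx; have [F [Ff Fx Fx']] := le_flag xx.
have [f fF] := regP Phif Ff.
have dual z : F z -> exists p q,
    [/\ Phi p, Phi q, (rk p + rk q = n%:Z - 1)%R & z = f p].
  rewrite -{1}fF => -[p Pp fp]; have := rank_range polyP p => rp.
  have [|q Pq rq] := @flag_rank_surj Phi (n%:Z - 1 - rk p)%R Phif; first by lia.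
  by exists p, q; split=> //; lia.
have [p [q [Pp Pq r xE]]] := dual _ Fx.
have [p' [q' [Pp' Pq' r' xE']]] := dual _ Fx'.
exists (alpha_conj f q), (alpha_conj f q').
split; [by exists f, p, q|by exists f, p', q'|].
rewrite autf_mono.
have rpp : (rk p <= rk p')%R.
  move: xx; rewrite xE xE' autf_mono le_eqVlt => /orP[/eqP->//|].
  by move=> /(rank_mono polyP)/ltW.
have [qq|qq] : rk q' = rk q \/ (rk q' < rk q)%R by lia.
  by rewrite (flag_rank_inj Phif Pq' Pq qq).
exact/ltW/(flag_rank_lt Phif).
Qed.

Lemma self_dual_of_reversing : self_dual P.
Proof.
have /choice[delta dP] : forall x, exists y, dual_rel x y.
  by move=> x; have [y [y' [xy _ _]]] := dual_rel_le (lexx x); exists y.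
have dK : involutive delta.
  by move=> x; apply: (dual_rel_fun (dP _)); apply: dual_rel_sym.
have anti x y : x <= y -> delta y <= delta x.
  move=> /dual_rel_le[x' [y' [xx yy]]].
  by rewrite (dual_rel_fun (dP x) xx) (dual_rel_fun (dP y) yy).
exists delta; split; first by exists delta.
by move=> x y; apply/idP/idP => /anti//; rewrite !dK.
Qed.

End Duality.
End Generators.
End Polytope.
End Flags.

(** * Reversing the path *)

Lemma path_edge_rev (n : nat) (i : 'I_n) (a b : 'I_(n + 3)) : (2 <= n)%N ->
  path_edge (rev_ord i) (rev_ord a) (rev_ord b) = path_edge i a b.
Proof.
move=> n2.
have labE k j : (nth 0 (path_labels n) k == j) =
    [|| (k == 0) && (j == 1), (0 < k <= n) && (j.+1 == k),
        (k == n.+1) && (j == n - 2) | (n.+1 < k) && (j == 0)].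
  rewrite /path_labels; case: k => [|k] /=; first by lia.
  by rewrite nth_rcons size_iota; case: ltngtP => kn;
    rewrite ?nth_iota//; lia.
have lab_rev k j : k < n.+2 -> j < n ->
    (nth 0 (path_labels n) (n.+1 - k) == n - j.+1)
    = (nth 0 (path_labels n) k == j).
  by move=> kn jn; rewrite !labE; lia.
have step (x y : 'I_(n + 3)) :
    (rev_ord y == (rev_ord x).+1 :> nat)
      && (nth 0 (path_labels n) (rev_ord x) == rev_ord i)
    = (x == y.+1 :> nat) && (nth 0 (path_labels n) y == i).
  have -> : (rev_ord y == (rev_ord x).+1 :> nat) = (x == y.+1 :> nat).
    by have := ltn_ord x; have := ltn_ord y; rewrite /=; lia.
  have [xy|//] := eqVneq (x : nat) y.+1; have xn := ltn_ord x.
  rewrite -(lab_rev y i) ?ltn_ord//; last by lia.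
  by congr (nth _ _ _ == _) => /=; lia.
by rewrite /path_edge !step orbC.
Qed.

(** For involutions the edges of the graph determine the permutation: a point
    with no edge of label [i] is fixed by [s i], whereas in general it could
    lie on a longer cycle. *)
Lemma reversal_conj (n m : nat) (s : 'I_n -> 'S_m) (pi : 'S_m) :
  (forall i, s i * s i = 1)%g ->
  (forall i a b, cpr_edge s (rev_ord i) (pi a) (pi b) = cpr_edge s i a b) ->
  forall i, (pi * s i = s (rev_ord i) * pi)%g.
Proof.
move=> s2 h i.
have sK j a : s j (s j a) = a by rewrite -permM s2 perm1.
have edge j a : s j a != a -> cpr_edge s j a (s j a).
  by move=> ne; rewrite /cpr_edge sK !eqxx eq_sym ne.
apply/permP => a; rewrite !permM.
have [e|/edge] := eqVneq (s (rev_ord i) a) a; last first.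
  by rewrite -h rev_ordK => /and3P[_ /eqP].
rewrite e; apply/eqP; apply/negPn/negP => /edge.
rewrite -[s i (pi a)](permKV pi) -{1}[i]rev_ordK h => /and3P[].
by rewrite e => ne /eqP e'; rewrite -e' eqxx in ne.
Qed.

Theorem proposition5p9 (n : nat) (hn : (5 <= n)%N) (d : Order.disp_t)
    (P : tbPOrderType d) (rk : P -> int)
    (Phi : set P) (rho : 'I_n -> polytope_aut P)
    (iso : {multiplicative polytope_aut P -> 'S_(n + 3)}) :
  regular_polytope n rk ->
  is_flag Phi ->
  distinguished_generators rk Phi rho ->
  bijective iso ->
  (forall (i : 'I_n) (a b : 'I_(n + 3)),
     cpr_edge (fun j => iso (rho j)) i a b = path_edge i a b) ->
  internally_self_dual rho.
Proof.
move=> [polyP regP] Phif rhoP [iso' isoK iso'K] cprE.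
have iso1 : iso 1%g = 1%g.
  by apply: (mulgI (iso 1%g)); rewrite -gmulfM !mulg1.
pose pi := perm (@rev_ord_inj (n + 3)).
have pi2 : (pi * pi = 1)%g.
  by apply/permP => a; rewrite permM !permE rev_ordK.
have inj := can_inj isoK.
have alpha2 : (iso' pi * iso' pi = 1)%g.
  by apply: inj; rewrite gmulfM iso'K pi2 iso1.
have alphaP (i : 'I_n) : (iso' pi * rho i = rho (rev_ord i) * iso' pi)%g.
  apply: inj; rewrite !gmulfM iso'K.
  apply: (@reversal_conj _ _ (fun j => iso (rho j))) => [j|j a b].
    by rewrite -gmulfM (rho_invol polyP Phif rhoP) iso1.
  by rewrite !cprE !permE path_edge_rev//; lia.
split; last by exists (iso' pi).
exact: (self_dual_of_reversing polyP Phif rhoP regP alpha2 alphaP).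
Qed.
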